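(* Let $f$ be additively separable into functions $f_i$, $i=1,\dots,n$, where each $f_i:[0,1]\to\mathbb{R}$ is twice differentiable in the interior of its domain with $f_i''>0$ (hence $f_i$ is strictly convex, and $f_i'$ is strictly increasing and therefore invertible, with inverse denoted ${f_i'}^{-1}$). Let $0\leqslant\mu\leqslant\mu_{\max}=\sum_{i=1}^n w_i$. Consider the following optimization problem in the variables $\delta_1,\dots,\delta_n$: $$\begin{aligned}&\text{minimize} && \sum_{i=1}^n f_i(\delta_i)\\ &\text{subject to} && 0\leqslant\delta_i\leqslant 1\ \text{ for } i=1,\dots,n,\\ &&&\sum_{i=1}^n d_i\delta_i=0\ \text{ and }\ \sum_{i=1}^n w_i\delta_i=\mu.\end{aligned}$$ Then the solution $\delta^*$ to the problem exists, is unique, and is of the form $$\delta_i^*=\max\left\{0,\min\{{f_i'}^{-1}(\alpha\, d_i+\beta\, w_i),1\}\right\},\qquad i=1,\dots,n,$$ for some real numbers $\alpha,\beta$ such that $\sum_i d_i\delta_i^*=0$ and $\sum_i w_i\delta_i^*=\mu$.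
   Context: Let $n\geqslant 2$, let $p=(p_1,\dots,p_n)$ and $q=(q_1,\dots,q_n)$ be probability distributions on $\{1,\dots,n\}$ with all $p_i,q_i>0$ and $q_i\neq p_i$ for all $i$, and put $d_i=q_i-p_i$. Let $w=(w_1,\dots,w_n)$ with all $w_i>0$. Convention: $f_i'(0)$ and $f_i'(1)$ denote the one-sided derivatives of $f_i$ at the endpoints, which are taken to exist. The expression $\max\{0,\min\{{f_i'}^{-1}(x),1\}\}$ is understood for every real $x$ as follows: it equals $0$ if $x\leqslant f_i'(0)$, it equals $1$ if $x\geqslant f_i'(1)$, and it equals the unique $y\in(0,1)$ with $f_i'(y)=x$ if $f_i'(0)<x<f_i'(1)$. *)

(* Defs.v *)
From HB Require Import structures.
From mathcomp Require Import all_boot all_order all_algebra.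
From mathcomp Require Import all_classical all_reals all_analysis.
Set Implicit Arguments.
Unset Strict Implicit.
Unset Printing Implicit Defensive.
Import Order.TTheory GRing.Theory Num.Theory.
Import numFieldNormedType.Exports.
Local Open Scope classical_set_scope.
Local Open Scope ring_scope.

Definition pos_distribution (R : realType) (n : nat) (p : 'rV[R]_n) : Prop :=
  (forall i, 0 < p 0 i) /\ \sum_i p 0 i = 1.

Definition diff_quotient (R : realType) (g : R -> R) (a h : R) : R :=
  h^-1 * (g (a + h) - g a).

Definition right_derivable (R : realType) (g : R -> R) (a : R) : Prop :=
  cvg (diff_quotient g a h @[h --> 0^'+]).

Definition left_derivable (R : realType) (g : R -> R) (a : R) : Prop :=
  cvg (diff_quotient g a h @[h --> 0^'-]).

Definition right_derive (R : realType) (g : R -> R) (a : R) : R :=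
  lim (diff_quotient g a h @[h --> 0^'+]).

Definition left_derive (R : realType) (g : R -> R) (a : R) : R :=
  lim (diff_quotient g a h @[h --> 0^'-]).

(* A function [0, 1] -> R is represented by a total g : R -> R whose values
   outside [0, 1] are irrelevant: the quotients at 0 and 1 are only taken from
   inside, and derivability on the open interval is a local property. *)
Definition admissible (R : realType) (g : R -> R) : Prop :=
  [/\ right_derivable g 0,
      left_derivable g 1 &
      forall x, 0 < x < 1 ->
        [/\ derivable g x 1, derivable (derive1 g) x 1 &
            0 < derive1 (derive1 g) x]].

(* The value of max {0, min {g'^-1(x), 1}} at every real x, where g' runs over
   [0, 1] with one-sided derivatives at the endpoints.  For an admissible g and
   g'(0) < x < g'(1), the set in the last branch is a singleton, so the default
   value of xget plays no role. *)
Definition clamped_derive_inv (R : realType) (g : R -> R) (x : R) : R :=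
  if x <= right_derive g 0 then 0
  else if left_derive g 1 <= x then 1
  else xget 0 [set y | 0 < y < 1 /\ derive1 g y = x].

Definition separable_sum (R : realType) (n : nat) (f : 'I_n -> R -> R)
    (delta : 'rV[R]_n) : R :=
  \sum_i f i (delta 0 i).

Definition feasible (R : realType) (n : nat) (d w : 'rV[R]_n) (mu : R) :
    set 'rV[R]_n :=
  [set delta | [/\ forall i, 0 <= delta 0 i <= 1,
                   \sum_i d 0 i * delta 0 i = 0 &
                   \sum_i w 0 i * delta 0 i = mu]].

Definition minimizer (R : realType) (n : nat) (F : 'rV[R]_n -> R)
    (A : set 'rV[R]_n) (delta : 'rV[R]_n) : Prop :=
  A delta /\ forall delta', A delta' -> F delta <= F delta'.

(* Main.v *)
(* Lagrangian duality.  For fixed multipliers (a, b) the Lagrangian separates, and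
   its i-th summand f_i(y) - x_i y, with x_i = a d_i + b w_i, has on [0, 1] the
   unique minimizer clamped_derive_inv (f i) x_i, by the mean value theorem and
   the monotonicity of f_i'.  Hence as soon as these minimizers satisfy the two
   constraints, they form the unique solution.
   For 0 < mu < \sum_i w_i, put t = mu / \sum_i w_i and let h_i be the convex
   conjugate of f_i on [0, 1], whose derivative is the clamped inverse.  As
   \sum_i d_i = 0, the dual function is \sum_i (h_i(x_i) - t x_i); it is
   coercive in (a, b) because 0 < t < 1 and d takes both signs, and the
   constraints say that its gradient vanishes, so its minimum gives (a, b). *)
Require Import Defs.
From HB Require Import structures.
From mathcomp Require Import all_boot all_order all_algebra.
From mathcomp Require Import all_classical all_reals all_analysis.
From mathcomp Require Import ring lra.
Set Implicit Arguments.
Unset Strict Implicit.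
Import Order.TTheory GRing.Theory Num.Theory.
Import numFieldNormedType.Exports.
Local Open Scope classical_set_scope.
Local Open Scope ring_scope.

(** * Mean value theorem and one-sided derivatives on [0, 1] *)

Lemma admissible_continuous (R : realType) (g : R -> R) :
  admissible g -> {within `[0, 1], continuous g}.
Proof.
move=> [gr gl gd]; apply/(continuous_within_itvP _ ltr01); split.
- move=> x; rewrite in_itv /= => /gd[dx _ _].
  exact/differentiable_continuous/derivable1_diffP.
(* Near an endpoint, g is its endpoint value plus h times the difference quotient; the quotient
   converges, so the second term tends to 0. *)
- have cg : (fun h => g 0 + h * diff_quotient g 0 h) h @[h --> 0^'+] -->
      g 0 + 0 * right_derive g 0.
    apply: cvgD; first exact: cvg_cst.
    by apply: cvgM => //; exact: cvg_at_right_filter.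
  rewrite mul0r addr0 in cg; apply: cvg_trans cg; apply: near_eq_cvg.
  near=> h; have h0 : 0 < h by near: h; exact: nbhs_right_gt.
  by rewrite /diff_quotient add0r mulrA mulfV ?gt_eqF// mul1r addrC subrK.
- have cg : (fun h => g 1 + h * diff_quotient g 1 h) h @[h --> 0^'-] -->
      g 1 + 0 * left_derive g 1.
    apply: cvgD; first exact: cvg_cst.
    by apply: cvgM => //; exact: cvg_at_left_filter.
  rewrite mul0r addr0 in cg.
  apply/cvgrPdist_lt => e e0; move/cvgrPdist_lt/(_ e e0): cg.
  rewrite !nbhs_left0P; apply: filterS2 (nbhs_right_gt 0) => h h0.
  rewrite sub0r /diff_quotient mulrA mulfV ?oppr_eq0 ?gt_eqF//.
  by rewrite mul1r [g 1 + (_ - g 1)]addrC subrK.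
Unshelve. all: by end_near. Qed.

Lemma admissible_MVT (R : realType) (g : R -> R) (a b : R) :
  admissible g -> 0 <= a -> a < b -> b <= 1 ->
  exists2 c, a < c < b & g b - g a = derive1 g c * (b - a).
Proof.
move=> ag a0 ab b1; have [_ _ gd] := ag.
have [||c] := @MVT R g (derive1 g) a b ab; last by rewrite in_itv; exists c.
  move=> x; rewrite in_itv /= => /andP[ax xb].
  have [|dx _ _] := gd x; first by rewrite (le_lt_trans a0 ax) (lt_le_trans xb b1).
  by rewrite derive1E; exact: derivableP.
apply: (continuous_subspaceW _ (admissible_continuous ag)).
by apply: subset_itv; rewrite bnd_simp.
Qed.

Lemma derive1_increasing (R : realType) (g : R -> R) (x y : R) :
  admissible g -> 0 < x -> x < y -> y < 1 -> derive1 g x < derive1 g y.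
Proof.
move=> [_ _ gd] x0 xy y1.
apply: (@gtr0_derive1_lt_oo R (derive1 g) 0 1) => //.
- by move=> z; rewrite in_itv => /gd[].
- by move=> z; rewrite in_itv => /gd[].
- move=> z /[1!inE] /=; rewrite in_itv /= => /gd[_ dz _].
  exact/differentiable_continuous/derivable1_diffP.
- by rewrite in_itv /= x0 (lt_trans xy y1).
- by rewrite in_itv /= y1 (lt_trans x0 xy).
Qed.

Lemma ltr_derive1 (R : realType) (g : R -> R) (x y : R) :
  admissible g -> 0 < x < 1 -> 0 < y < 1 ->
  (derive1 g x < derive1 g y) = (x < y).
Proof.
move=> ag /andP[x0 x1] /andP[y0 y1]; case: (ltgtP x y) => [xy|yx|->].
- exact: derive1_increasing.
- by apply/negbTE; rewrite -leNgt ltW// derive1_increasing.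
- by rewrite ltxx.
Qed.

(** By the mean value theorem, quotients with h < c / 2 are values of g' left of c / 2, so their
    limit is at most g'(c / 2). Stopping at c / 2 instead of c keeps the inequality strict in the
    limit. *)
Lemma right_derive_lt (R : realType) (g : R -> R) (c : R) :
  admissible g -> 0 < c < 1 -> right_derive g 0 < derive1 g c.
Proof.
move=> ag /andP[c0 c1]; have [gr _ _] := ag.
apply: (@le_lt_trans _ _ (derive1 g (c / 2))); last first.
  by apply: derive1_increasing => //; lra.
apply: limr_le => //; near=> h.
have h0 : 0 < h by near: h; exact: nbhs_right_gt.
have hc : h < c / 2 by near: h; apply: nbhs_right_lt; lra.
have [||||e /andP[e0 eh]] := @admissible_MVT R g 0 h; rewrite ?lexx//; first lra.
rewrite /diff_quotient add0r subr0 => ->.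
rewrite mulrC mulfK ?gt_eqF//; apply/ltW/derive1_increasing => //; lra.
Unshelve. all: by end_near. Qed.

Lemma left_derive_gt (R : realType) (g : R -> R) (c : R) :
  admissible g -> 0 < c < 1 -> derive1 g c < left_derive g 1.
Proof.
move=> ag /andP[c0 c1]; have [_ gl _] := ag.
apply: (@lt_le_trans _ _ (derive1 g ((c + 1) / 2))).
  by apply: derive1_increasing => //; lra.
apply: limr_ge => //; near=> h.
have h0 : h < 0 by near: h; exact: nbhs_left_lt.
have hc : (c - 1) / 2 < h by near: h; apply: nbhs_left_gt; lra.
have [||||e /andP[e0 eh]] := @admissible_MVT R g (1 + h) 1; rewrite ?lexx//; [lra..|].
move=> ge; have {}ge : g (1 + h) - g 1 = derive1 g e * h by rewrite -opprB ge; ring.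
by rewrite /diff_quotient ge [h^-1 * _]mulrC mulfK ?lt_eqF//; apply/ltW/derive1_increasing => //; lra.
Unshelve. all: by end_near. Qed.

(** Difference quotients close to the endpoints lie below, respectively above, x, and the mean value
    theorem turns them into values of g' at interior points. Since g' is derivable, hence
    continuous, the intermediate value theorem applies between these points. *)
Lemma derive1_surjective (R : realType) (g : R -> R) (x : R) :
  admissible g -> right_derive g 0 < x < left_derive g 1 ->
  exists2 y, 0 < y < 1 & derive1 g y = x.
Proof.
move=> ag /andP[rx xl]; have [gr gl gd] := ag.
have [a a01 ax] : exists2 a, 0 < a < 1 & derive1 g a < x.
  have [h [/= h0 h1 hx]] : exists h, [/\ 0 < h, h < 1 & diff_quotient g 0 h < x].
    apply: (@filter_ex _ (0^'+)); near=> h; split.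
    - by near: h; exact: nbhs_right_gt.
    - by near: h; exact: nbhs_right_lt.
    - by near: h; exact: (cvgr_lt _ gr).
  have [||||e /andP[e0 eh]] := @admissible_MVT R g 0 h; rewrite ?lexx// ?ltW//.
  move=> ge; exists e; first by rewrite e0 (lt_trans eh).
  by move: hx; rewrite /diff_quotient add0r ge subr0 mulrC mulfK ?gt_eqF.
have [b b01 bx] : exists2 b, 0 < b < 1 & x < derive1 g b.
  have [h [/= h0 h1 hx]] : exists h, [/\ h < 0, -1 < h & x < diff_quotient g 1 h].
    apply: (@filter_ex _ (0^'-)); near=> h; split.
    - by near: h; exact: nbhs_left_lt.
    - by near: h; apply: nbhs_left_gt; lra.
    - by near: h; exact: (cvgr_gt _ gl).
  have [||||e /andP[e0 eh]] := @admissible_MVT R g (1 + h) 1; rewrite ?lexx//; [lra..|].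
  move=> ge; exists e; first by rewrite eh andbT; lra.
  have {}ge : g (1 + h) - g 1 = derive1 g e * h by rewrite -opprB ge; ring.
  by move: hx; rewrite /diff_quotient ge [h^-1 * _]mulrC mulfK ?lt_eqF.
have ab : a < b by rewrite -(ltr_derive1 ag)// (lt_trans ax bx).
have [||c] := @IVT R (derive1 g) a b x (ltW ab).
- apply: derivable_within_continuous => z; rewrite in_itv /= => /andP[az zb].
  by have [] : [/\ derivable g z 1, derivable (derive1 g) z 1 &
            0 < derive1 (derive1 g) z] by apply: gd; lra.
- by rewrite ge_min le_max (ltW ax) (ltW bx) orbT.
- rewrite in_itv /= => /andP[ac cb] gc; exists c => //; lra.
Unshelve. all: by end_near. Qed.

(** * The clamped inverse as a minimizer; its monotonicity and continuity *)

Lemma clamped_derive_invP (R : realType) (g : R -> R) (x : R) :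
  admissible g ->
  let y := clamped_derive_inv g x in
  [\/ x <= right_derive g 0 /\ y = 0, left_derive g 1 <= x /\ y = 1 |
      0 < y < 1 /\ derive1 g y = x].
Proof.
move=> ag; rewrite /clamped_derive_inv; case: ifPn => [|rx]; first by constructor 1.
case: ifPn => [|lx]; first by constructor 2.
have [|y y01 gy] := @derive1_surjective R g x ag; first by rewrite !ltNge rx.
by constructor 3; apply: (@xgetPex _ 0 [set y | 0 < y < 1 /\ derive1 g y = x]); exists y.
Qed.

Lemma clamped_derive_inv_itv (R : realType) (g : R -> R) (x : R) :
  admissible g -> 0 <= clamped_derive_inv g x <= 1.
Proof.
move=> /(clamped_derive_invP x)[[_ ->]|[_ ->]|[/andP[y0 y1] _]].
- by rewrite lexx ler01.
- by rewrite lexx ler01.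
- by rewrite !ltW.
Qed.

(** With z the clamped inverse at x, the mean value theorem gives a point e strictly between y and z
    at which the sign of g'(e) - x decides the inequality. In each of the three cases for z, this
    sign is negative left of z and positive right of z. *)
Lemma clamped_derive_inv_lt_min (R : realType) (g : R -> R) (x y : R) :
  admissible g -> 0 <= y <= 1 -> y != clamped_derive_inv g x ->
  g (clamped_derive_inv g x) - x * clamped_derive_inv g x < g y - x * y.
Proof.
move=> ag /andP[y0 y1]; have := clamped_derive_invP x ag.
have /andP[] := clamped_derive_inv_itv x ag.
set z := clamped_derive_inv g x => z0 z1 zP; rewrite neq_lt => /orP[yz|zy].
- have [e /andP[ye ez] ge] := admissible_MVT ag y0 yz z1.
  suff : derive1 g e < x by move=> ex; nra.
  case: zP => [[_ ze]|[lx ze]|[z01 <-]]; first lra.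
  + by apply: lt_le_trans lx; apply: left_derive_gt => //; lra.
  + by apply: derive1_increasing => //; lra.
- have [e /andP[ze ey] ge] := admissible_MVT ag z0 zy y1.
  suff : x < derive1 g e by move=> ex; nra.
  case: zP => [[xr z0']|[_ z1']|[z01 <-]]; last 2 first.
  + by lra.
  + by apply: derive1_increasing => //; lra.
  + by apply: le_lt_trans xr _; apply: right_derive_lt => //; lra.
Qed.

Lemma clamped_derive_inv_min (R : realType) (g : R -> R) (x y : R) :
  admissible g -> 0 <= y <= 1 ->
  g (clamped_derive_inv g x) - x * clamped_derive_inv g x <= g y - x * y.
Proof.
move=> ag y01; have [->//|yz] := eqVneq y (clamped_derive_inv g x).
exact/ltW/clamped_derive_inv_lt_min.
Qed.

(** Adding the optimality inequalities of the two minimizers, each tested against the other, cancels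
    g and leaves a product of differences of known sign. *)
Lemma clamped_derive_inv_homo (R : realType) (g : R -> R) :
  admissible g -> {homo clamped_derive_inv g : x y / x <= y}.
Proof.
move=> ag x y; rewrite le_eqVlt => /predU1P[->//|xy].
have := clamped_derive_inv_min x ag (clamped_derive_inv_itv y ag).
have := clamped_derive_inv_min y ag (clamped_derive_inv_itv x ag).
move=> Hy Hx; rewrite leNgt; apply/negP => yx.
have : 0 < (y - x) * (clamped_derive_inv g x - clamped_derive_inv g y).
  by rewrite mulr_gt0// subr_gt0.
lra.
Qed.

Lemma derive1K (R : realType) (g : R -> R) (y : R) :
  admissible g -> 0 < y < 1 -> clamped_derive_inv g (derive1 g y) = y.
Proof.
move=> ag y01.
have [[gr _]|[gl _]|[z01 gz]] := clamped_derive_invP (derive1 g y) ag.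
- by have := right_derive_lt ag y01; rewrite ltNge gr.
- by have := left_derive_gt ag y01; rewrite ltNge gl.
- have [zy|yz|//] := ltgtP (clamped_derive_inv g (derive1 g y)) y.
  + by move: zy; rewrite -(ltr_derive1 ag)// gz ltxx.
  + by move: yz; rewrite -(ltr_derive1 ag)// gz ltxx.
Qed.

Lemma clamped_derive_inv_continuous (R : realType) (g : R -> R) :
  admissible g -> continuous (clamped_derive_inv g).
Proof.
move=> ag x; apply/cvgrPdist_lt => e e0.
have /andP[z0 z1] := clamped_derive_inv_itv x ag.
set z := clamped_derive_inv g x in z0 z1 *.
have up : \near x, clamped_derive_inv g x < z + e.
  have [ze|ze] := ltP 1 (z + e).
    near=> u; have /andP[_ u1] := clamped_derive_inv_itv u ag.
    exact: le_lt_trans ze.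
  (* The point z + e / 2 is interior, hence the clamped inverse of its own derivative value; that
     value exceeds x, and monotonicity bounds the clamped inverse at every u below it. *)
  have y01 : 0 < z + e / 2 < 1 by lra.
  have xy : x < derive1 g (z + e / 2).
    rewrite ltNge; apply/negP => /(clamped_derive_inv_homo ag).
    rewrite derive1K// -/z; lra.
  near=> u; apply: (@le_lt_trans _ _ (z + e / 2)); last lra.
  rewrite -[leRHS](derive1K ag)//; apply: clamped_derive_inv_homo => //.
  by apply/ltW; near: u; exact: (cvgr_lt x (@cvg_id _ _)).
have lo : \near x, z - e < clamped_derive_inv g x.
  have [ze|ze] := ltP (z - e) 0.
    near=> u; have /andP[u0 _] := clamped_derive_inv_itv u ag.
    exact: lt_le_trans u0.
  have y01 : 0 < z - e / 2 < 1 by lra.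
  have xy : derive1 g (z - e / 2) < x.
    rewrite ltNge; apply/negP => /(clamped_derive_inv_homo ag).
    rewrite derive1K// -/z; lra.
  near=> u; apply: (@lt_le_trans _ _ (z - e / 2)); first lra.
  rewrite -[leLHS](derive1K ag)//; apply: clamped_derive_inv_homo => //.
  by apply/ltW; near: u; exact: (cvgr_gt x (@cvg_id _ _)).
by near=> u; rewrite ltr_distlC; apply/andP; split; near: u.
Unshelve. all: by end_near. Qed.

(** * Minimizing a coercive convex sum over two multipliers *)

(* First-order condition: S s * s bounds the increment of a function from its
   minimum at 0. *)
Lemma sign_mul_ge0_eq0 (R : realType) (S : R -> R) :
  {for 0, continuous S} -> (forall s, 0 <= S s * s) -> S 0 = 0.
Proof.
move=> cS S0; apply/eqP; rewrite eq_le; apply/andP; split.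
- apply: (cvgr_to_le (cvg_at_left_filter cS)); near=> s.
  have s0 : s < 0 by near: s; exact: nbhs_left_lt.
  by rewrite -(nmulr_lge0 _ s0).
- apply: (cvgr_to_ge (cvg_at_right_filter cS)); near=> s.
  have s0 : 0 < s by near: s; exact: nbhs_right_gt.
  by rewrite -(pmulr_lge0 _ s0).
Unshelve. all: by end_near. Qed.

Lemma continuous_sumr (R : realType) (T : topologicalType) (n : nat)
    (F : 'I_n -> T -> R) :
  (forall i, continuous (F i)) -> continuous (fun x => \sum_i F i x).
Proof.
by move=> Fc; apply: continuous_big => // -[x y]; exact: add_continuous.
Qed.

Lemma ler_norm_addr_ge0 (R : realType) (x y : R) : 0 <= x * y -> `|x| <= `|x + y|.
Proof.
move=> xy; rewrite -(ler_pXn2r (ltn0Sn 1)) ?nnegrE// !real_normK ?num_real//.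
have := sqr_ge0 y; rewrite sqrrD; lra.
Qed.

Section CoerciveSum.
Context (R : realType) (n : nat) (d w : 'I_n -> R) (psi s : 'I_n -> R -> R).
Context (c : R) (K : 'I_n -> R).
Hypothesis psi_subgradient : forall i x z, s i x * (z - x) <= psi i z - psi i x.
Hypothesis s_continuous : forall i, continuous (s i).
Hypothesis psi_continuous : forall i, continuous (psi i).
Hypothesis c_gt0 : 0 < c.
Hypothesis psi_coercive : forall i x, c * `|x| - K i <= psi i x.
Hypothesis w_gt0 : forall i, 0 < w i.

(** The pair z holds the two multipliers, and [G] is the abstract form of the dual function: each
    [psi i] is convex with subgradient [s i]. *)
Let u i (z : R * R) := z.1 * d i + z.2 * w i.
Let G z := \sum_i psi i (u i z).

Lemma coercive_sum_continuous : continuous G.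
Proof.
apply: continuous_sumr => i z; apply: (@continuous_comp _ _ _ (u i) (psi i)).
  by apply: cvgD; apply: cvgM;
    [exact: cvg_fst|exact: cvg_cst|exact: cvg_snd|exact: cvg_cst].
exact: psi_continuous.
Qed.

(** Coercivity bounds every [u k z] on a sublevel set. As w is positive and d takes both signs, some
    k in {i0, j0} gives the two terms of [u k z] compatible signs; they cannot cancel, so each
    multiplier is bounded separately. *)
Lemma coercive_sum_bounded (i0 j0 : 'I_n) (B : R) : 0 < d i0 -> d j0 < 0 ->
  exists M, forall z, G z <= B -> `|z.1| <= M /\ `|z.2| <= M.
Proof.
move=> di dj.
(* A common lower bound for |d| and w at both indices, so that the final bound does not depend on
   which index is chosen. *)
pose m := Num.min (Num.min (d i0) (- d j0)) (Num.min (w i0) (w j0)).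
have m0 : 0 < m by rewrite !lt_min di oppr_gt0 dj !w_gt0.
have mi : m <= d i0 by rewrite !ge_min lexx.
have mj : m <= - d j0 by rewrite !ge_min lexx orbT.
have mwi : m <= w i0 by rewrite !ge_min lexx !orbT.
have mwj : m <= w j0 by rewrite !ge_min lexx !orbT.
exists ((B + \sum_i K i) / (c * m)) => z GB.
(* The terms other than the k-th are at least -K i, which isolates the k-th one. *)
have cu k : c * `|u k z| <= B + \sum_i K i.
  rewrite -lerBlDr (le_trans _ GB)// /G (bigD1 k)//= [X in _ <= X](bigD1 k)//=.
  rewrite opprD addrA lerD// -sumrN ler_sum// => i _.
  have := psi_coercive i (u i z); have := mulr_ge0 (ltW c_gt0) (normr_ge0 (u i z)); lra.
have [k [mdk mwk dwk]] : exists k, [/\ m <= `|d k|, m <= w k &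
    0 <= (z.1 * d k) * (z.2 * w k)].
  have [z12|/ltW z12] := leP 0 (z.1 * z.2).
    exists i0; rewrite gtr0_norm//; split => //.
    by rewrite mulrACA mulr_ge0// mulr_ge0// ltW.
  exists j0; rewrite ltr0_norm//; split => //.
  by rewrite mulrACA mulr_le0// nmulr_rle0// ltW.
have u1 : m * `|z.1| <= `|u k z|.
  rewrite (le_trans _ (ler_norm_addr_ge0 dwk))// normrM mulrC.
  by rewrite ler_wpM2l.
have u2 : m * `|z.2| <= `|u k z|.
  rewrite mulrC in dwk; rewrite /u addrC (le_trans _ (ler_norm_addr_ge0 dwk))//.
  by rewrite normrM mulrC ler_wpM2l// gtr0_norm.
have cm0 : 0 < c * m by rewrite mulr_gt0.
rewrite !ler_pdivlMr//; split; rewrite mulrC -mulrA (le_trans _ (cu k))// ler_pM2l//.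
Qed.

(** A compact square containing the sublevel set of G (0, 0) carries a minimum of [G], which is
    therefore global. Moving one multiplier at a time gives the two equations. *)
Lemma coercive_sum_stationary (i0 j0 : 'I_n) : 0 < d i0 -> d j0 < 0 ->
  exists a b, \sum_i d i * s i (a * d i + b * w i) = 0 /\
              \sum_i w i * s i (a * d i + b * w i) = 0.
Proof.
move=> di dj; have [M GM] := coercive_sum_bounded (G (0, 0)) di dj.
have M0 : 0 <= M by have [|/= + _] := GM (0, 0); [exact: lexx|rewrite normr0].
pose A := (`[- M, M] `*` `[- M, M])%classic : set (R * R).
have AP z : A z <-> `|z.1| <= M /\ `|z.2| <= M.
  by rewrite /A /= !in_itv /= !ler_norml.
have [z0 z0A z0min] : exists2 z0, z0 \in A & forall z, z \in A -> G z0 <= G z.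
  apply: compact_EVT_min.
  - by exists (0, 0); apply/AP; rewrite /= normr0.
  - by apply: compact_setX; exact: segment_compact.
  - exact/continuous_subspaceT/coercive_sum_continuous.
have {}z0min z : G z0 <= G z.
  have [/GM/AP zA|/ltW Gz] := leP (G z) (G (0, 0)); first by rewrite z0min// inE.
  by rewrite (le_trans _ Gz)// z0min// inE; apply/AP; rewrite /= normr0.
(* Along a path that shifts each [u i] by t * e i, the subgradient inequality at the moved point
   shows that [S t * t] bounds the increment of [G] from its minimum, so it is nonnegative. *)
have stat (e : 'I_n -> R) (z : R -> R * R) :
    (forall i t, u i (z t) = u i z0 + t * e i) -> \sum_i e i * s i (u i z0) = 0.
  move=> ze; pose S t := \sum_i e i * s i (u i z0 + t * e i).
  have -> : \sum_i e i * s i (u i z0) = S 0.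
    by apply: eq_bigr => i _; rewrite mul0r addr0.
  apply: sign_mul_ge0_eq0 => [|t].
    apply: continuous_sumr => i t; apply: cvgM; first exact: cvg_cst.
    apply: (@cvg_comp _ _ _ (fun r => u i z0 + r * e i) (s i) _
      (nbhs (u i z0 + t * e i))); last exact: s_continuous.
    by apply: cvgD; [exact: cvg_cst|apply: cvgM; [exact: cvg_id|exact: cvg_cst]].
  have := z0min (z t); rewrite -subr_ge0 /G -sumrB => /le_trans; apply.
  rewrite /S mulr_suml ler_sum// => i _; rewrite ze.
  have := psi_subgradient i (u i z0 + t * e i) (u i z0); lra.
exists z0.1, z0.2; split.
- apply: (stat _ (fun t => (z0.1 + t, z0.2))) => i t; rewrite /u /=; ring.
- apply: (stat _ (fun t => (z0.1, z0.2 + t))) => i t; rewrite /u /=; ring.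
Qed.

End CoerciveSum.

(** * The convex conjugate on [0, 1] *)

Lemma right_derive_lt_left_derive (R : realType) (g : R -> R) :
  admissible g -> right_derive g 0 < left_derive g 1.
Proof.
move=> ag; have h01 : 0 < (2^-1 : R) < 1 by lra.
exact: lt_trans (right_derive_lt ag h01) (left_derive_gt ag h01).
Qed.

(** The supremum of x * y - g y over y in [0, 1], written at the point that attains it. *)
Definition conjugate01 (R : realType) (g : R -> R) (x : R) : R :=
  x * clamped_derive_inv g x - g (clamped_derive_inv g x).

Lemma conjugate01_subgradient (R : realType) (g : R -> R) (x z : R) :
  admissible g ->
  clamped_derive_inv g x * (z - x) <= conjugate01 g z - conjugate01 g x.
Proof.
move=> ag; rewrite /conjugate01.
have := clamped_derive_inv_min z ag (clamped_derive_inv_itv x ag); lra.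
Qed.

(** All the subgradients lie in [0, 1], so the conjugate is 1-Lipschitz. *)
Lemma conjugate01_continuous (R : realType) (g : R -> R) :
  admissible g -> continuous (conjugate01 g).
Proof.
move=> ag x; apply/cvgrPdist_lt => e e0; near=> z.
apply: (@le_lt_trans _ _ `|x - z|); last first.
  by near: z; exact: (@cvgr_dist_lt _ _ _ _ _ id x (@cvg_id _ _)).
have /andP[x0 x1] := clamped_derive_inv_itv x ag.
have /andP[z0 z1] := clamped_derive_inv_itv z ag.
have := conjugate01_subgradient x z ag; have := conjugate01_subgradient z x ag.
rewrite ler_norml => Hx Hz; have [zx|zx] := leP z x.
  by rewrite ger0_norm ?subr_ge0//; apply/andP; split; nra.
by rewrite ltr0_norm ?subr_lt0//; apply/andP; split; nra.
Unshelve. all: by end_near. Qed.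

(** Testing the supremum at y = 1 gives slope 1 - t for x >= 0, and testing it at y = 0 gives slope
    t in |x| for x < 0. *)
Lemma conjugate01_coercive (R : realType) (g : R -> R) (t x : R) :
  admissible g -> 0 < t < 1 ->
  Num.min t (1 - t) * `|x| - (`|g 0| + `|g 1|) <= conjugate01 g x - t * x.
Proof.
move=> ag /andP[t0 t1]; rewrite /conjugate01.
have h0 := @clamped_derive_inv_min R g x 0 ag.
have h1 := @clamped_derive_inv_min R g x 1 ag.
rewrite !lexx !ler01 in h0 h1; move: (h0 isT) (h1 isT) => {}h0 {}h1.
have := ler_norm (g 0); have := ler_norm (g 1).
have := normr_ge0 (g 0); have := normr_ge0 (g 1).
have mt : Num.min t (1 - t) <= t by rewrite ge_min lexx.
have m1t : Num.min t (1 - t) <= 1 - t by rewrite ge_min lexx orbT.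
have [x0|x0] := leP 0 x.
  by rewrite (ger0_norm x0); have := ler_wpM2r x0 m1t; lra.
have nx0 : 0 <= - x by rewrite oppr_ge0 ltW.
by rewrite (ltr0_norm x0); have := ler_wpM2r nx0 mt; lra.
Qed.

(** * Existence of the multipliers *)

Section Multipliers.
Context (R : realType) (n : nat) (d w : 'I_n -> R) (f : 'I_n -> R -> R).
Hypothesis f_admissible : forall i, admissible (f i).
Hypothesis w_gt0 : forall i, 0 < w i.
Hypothesis d_sum0 : \sum_i d i = 0.

Let delta a b i := clamped_derive_inv (f i) (a * d i + b * w i).

Lemma multipliers_interior (i0 j0 : 'I_n) (mu : R) :
  0 < d i0 -> d j0 < 0 -> 0 < mu < \sum_i w i ->
  exists a b, \sum_i d i * delta a b i = 0 /\ \sum_i w i * delta a b i = mu.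
Proof.
move=> di dj /andP[mu0 muW]; set W := \sum_i w i in muW.
have W0 : 0 < W := lt_trans mu0 muW.
(* Replacing each clamped inverse by its difference with t makes both constraints homogeneous: the
   d-sum is unchanged because d sums to 0, and the w-sum drops by W * t = mu. *)
pose t := mu / W.
have t0 : 0 < t by rewrite divr_gt0.
have t1 : t < 1 by rewrite ltr_pdivrMr// mul1r.
have [||||||a [b [da wb]]] := @coercive_sum_stationary R n d w
  (fun i x => conjugate01 (f i) x - t * x)
  (fun i x => clamped_derive_inv (f i) x - t)
  (Num.min t (1 - t)) (fun i => `|f i 0| + `|f i 1|) _ _ _ _ _ _ i0 j0 di dj.
- by move=> i x z; have := conjugate01_subgradient x z (f_admissible i); lra.
- move=> i x; apply: cvgB; last exact: cvg_cst.
  exact: clamped_derive_inv_continuous.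
- move=> i x; apply: cvgB; first exact: conjugate01_continuous.
  by apply: cvgM; [exact: cvg_cst|exact: cvg_id].
- by rewrite lt_min t0 subr_gt0.
- by move=> i x; apply: conjugate01_coercive => //; rewrite t0.
- exact: w_gt0.
have sumBt (e : 'I_n -> R) : \sum_i e i * (delta a b i - t) =
    \sum_i e i * delta a b i - (\sum_i e i) * t.
  by rewrite mulr_suml -sumrB; apply: eq_bigr => i _; rewrite mulrBr.
exists a, b; split.
- by move: da; rewrite sumBt d_sum0 mul0r subr0.
- transitivity (W * t); last by rewrite /t mulrC divfK// gt_eqF.
  by apply: subr0_eq; rewrite -sumBt.
Qed.

(** One multiple of w dominates any given vector r; at the extreme values of mu this pushes all
    arguments past the endpoint derivatives at once. *)
Lemma scaled_sum_ge (r : 'I_n -> R) (i : 'I_n) :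
  r i <= (\sum_j `|r j| / w j) * w i.
Proof.
rewrite -ler_pdivrMr// (bigD1 i)//=.
apply: (@le_trans _ _ (`|r i| / w i)).
  by rewrite ler_pM2r ?invr_gt0// ler_norm.
by rewrite lerDl sumr_ge0// => j _; rewrite divr_ge0// ltW.
Qed.

Lemma multipliers (i0 j0 : 'I_n) (mu : R) :
  0 < d i0 -> d j0 < 0 -> 0 <= mu <= \sum_i w i ->
  exists a b, \sum_i d i * delta a b i = 0 /\ \sum_i w i * delta a b i = mu.
Proof.
move=> di dj /andP[]; rewrite le_eqVlt => /predU1P[<- _|mu0].
  (* For mu = 0, a sufficiently negative multiple of w puts every argument at or below f_i'(0), so
     every coordinate is 0. *)
  exists 0, (- \sum_j `|- right_derive (f j) 0| / w j).
  have d0 i : delta 0 (- \sum_j `|- right_derive (f j) 0| / w j) i = 0.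
    rewrite /delta /clamped_derive_inv mul0r add0r ifT// mulNr lerNl.
    exact: (scaled_sum_ge (fun j => - right_derive (f j) 0)).
  by split; rewrite big1// => i _; rewrite d0 mulr0.
rewrite le_eqVlt => /predU1P[->|muW]; last by apply: (multipliers_interior di dj); rewrite mu0.
(* For mu equal to the sum of w, every argument reaches f_i'(1), so every coordinate is 1. The
   definition tests f_i'(0) first, hence the need for f_i'(0) < f_i'(1). *)
exists 0, (\sum_j `|left_derive (f j) 1| / w j).
have d1 i : delta 0 (\sum_j `|left_derive (f j) 1| / w j) i = 1.
  have lx := scaled_sum_ge (fun j => left_derive (f j) 1) i.
  rewrite /delta /clamped_derive_inv mul0r add0r lx ifF//.
  by apply/negbTE; rewrite -ltNge (lt_le_trans _ lx)// right_derive_lt_left_derive.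
by split; [rewrite -[RHS]d_sum0|]; apply: eq_bigr => i _; rewrite d1 mulr1.
Qed.

End Multipliers.

(** * Optimality and uniqueness from the multipliers *)

Lemma exists_gt0_of_sum0 (R : realType) (n : nat) (d : 'I_n -> R) :
  \sum_i d i = 0 -> (exists i, d i != 0) -> exists i, 0 < d i.
Proof.
move=> d0 [i di]; apply: contrapT => /forallNP dle.
have dge j : 0 <= - d j by rewrite oppr_ge0 leNgt; apply/negP.
have /eqP := congr1 -%R d0; rewrite oppr0 -sumrN psumr_eq0// => /allP /(_ i).
by rewrite mem_index_enum oppr_eq0 (negbTE di) => /(_ isT).
Qed.

(** On the feasible set the multiplier terms add up to a * 0 + b * mu, so comparing objectives
    amounts to comparing Lagrangians, which can be done coordinate by coordinate. *)
Lemma separable_sum_lagrangian (R : realType) (n : nat) (d w : 'rV[R]_n)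
    (f : 'I_n -> R -> R) (mu a b : R) (y : 'rV[R]_n) :
  feasible d w mu y ->
  separable_sum f y =
  \sum_i (f i (y 0 i) - (a * d 0 i + b * w 0 i) * y 0 i) + b * mu.
Proof.
move=> [_ dy wy]; rewrite -[b * mu]add0r -wy -[X in X + b * _](mulr0 a) -[X in a * X]dy.
rewrite !mulr_sumr -!big_split /=; apply: eq_bigr => i _; ring.
Qed.

Theorem lemma4 (R : realType) (n : nat) (hn : (2 <= n)%N)
    (p q w : 'rV[R]_n)
    (hp : pos_distribution p) (hq : pos_distribution q)
    (hpq : forall i, q 0 i != p 0 i)
    (hw : forall i, 0 < w 0 i)
    (f : 'I_n -> R -> R) (hf : forall i, admissible (f i))
    (mu : R) (hmu : 0 <= mu <= \sum_i w 0 i) :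
  let d := q - p in
  let is_solution := minimizer (separable_sum f) (feasible d w mu) in
  exists delta : 'rV[R]_n,
    [/\ is_solution delta,
        forall delta', is_solution delta' -> delta' = delta &
        exists alpha beta : R,
          [/\ forall i, delta 0 i =
                clamped_derive_inv (f i) (alpha * d 0 i + beta * w 0 i),
              \sum_i d 0 i * delta 0 i = 0 &
              \sum_i w 0 i * delta 0 i = mu]].
Proof.
move=> d is_solution.
have d0 : \sum_i d 0 i = 0.
  under eq_bigr do rewrite !mxE.
  by rewrite sumrB hp.2 hq.2 subrr.
have dn0 i : d 0 i != 0 by rewrite !mxE subr_eq0.
pose k : 'I_n := Ordinal (ltnW hn).
have [i0 di] : exists i, 0 < d 0 i by apply: exists_gt0_of_sum0 => //; exists k.
have [j0] : exists j, 0 < - d 0 j.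
  by apply: exists_gt0_of_sum0; [rewrite sumrN d0 oppr0|exists k; rewrite oppr_eq0].
rewrite oppr_gt0 => dj.
have [a [b [da wb]]] := multipliers hf hw d0 di dj hmu.
pose x i := a * d 0 i + b * w 0 i.
pose delta : 'rV[R]_n := \row_i clamped_derive_inv (f i) (x i).
have deltaE i : delta 0 i = clamped_derive_inv (f i) (x i) by rewrite mxE.
have dd : \sum_i d 0 i * delta 0 i = 0.
  by rewrite -[RHS]da; apply: eq_bigr => i _; rewrite deltaE.
have dw : \sum_i w 0 i * delta 0 i = mu.
  by rewrite -[RHS]wb; apply: eq_bigr => i _; rewrite deltaE.
have fdelta : feasible d w mu delta.
  by split=> // i; rewrite deltaE; exact: clamped_derive_inv_itv.
(* This strict inequality yields both optimality and uniqueness: a coordinate where y differs from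
   [delta] is strictly worse, and no other coordinate is better. *)
have delta_lt y : feasible d w mu y -> y != delta ->
    separable_sum f delta < separable_sum f y.
  move=> fy; rewrite (separable_sum_lagrangian _ a b fy).
  rewrite (separable_sum_lagrangian _ a b fdelta) ltrD2r.
  have [y01 _ _] := fy; move=> ydelta.
  have [i yi] : exists i, y 0 i != delta 0 i.
    apply: contrapT => /forallNP yE; move/eqP: ydelta; apply; apply/rowP => i.
    by apply/eqP/negPn/negP/yE.
  rewrite (bigD1 i)//= [X in _ < X](bigD1 i)//= ltr_leD//.
    by rewrite deltaE clamped_derive_inv_lt_min// -deltaE.
  by apply: ler_sum => j _; rewrite deltaE clamped_derive_inv_min.
exists delta; split.
- by split=> // y fy; have [->//|/(delta_lt _ fy)/ltW] := eqVneq y delta.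
- move=> y [fy ymin]; apply/eqP/negPn/negP => /(delta_lt _ fy).
  by rewrite ltNge ymin.
- by exists a, b.
Qed.
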